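(* Let $\beta$ and $\alpha$ be the real constants $$\beta = \inf \left\{ \beta' \in \mathbb{R} : (\forall \epsilon > 0)(\exists N)(\forall T \neq \emptyset)\left( |T| \geq N \implies \frac{\mathrm{cost}(T)}{|T|} < \beta' + \epsilon \right)\right\}, \qquad \alpha = \lim_{h\to\infty} \frac{\mathrm{cost}(M_h)}{|M_h|},$$ where $T$ ranges over binary trees, $\mathrm{cost}(T)$ is the number of rotations in the splay-to-root traversal of $T$, and $M_h$ is the maximal binary tree of height $h$. Then $\beta \geq 2 + \alpha$.
   Context: ''Tree'' means finite binary tree (each node has a possibly empty left subtree and a possibly empty right subtree); $|T|$ is the number of nodes of $T$, and $\emptyset$ is the empty tree. The height of a nonempty tree is the number of links on a longest path from the root to a leaf. $M_h$ denotes the maximal tree of height $h$, i.e. the unique (up to isomorphism) tree of height $h$ with $2^{h+1}-1$ nodes. Splaying a node $x$ to the root (Sleator–Tarjan): while $x$ is not the root, let $p$ be its parent. If $p$ is the root, rotate the edge $xp$ (''zig'', 1 rotation). Otherwise let $g$ be the parent of $p$. If $x$ and $p$ are both left children or both right children, first rotate the edge $pg$, then the edge $xp$ (''zigzig'', 2 rotations). Otherwise rotate the edge $xp$ and then the edge joining $x$ to $g$ (''zigzag'', 2 rotations). Rotations preserve the inorder of the nodes. The splay-to-root traversal of $T$ splays to the root, one after another in inorder (first to last), every node of $T$, each time in the current tree. $\mathrm{cost}(T)$ is the total number of rotations performed in this traversal. It is known that $\mathrm{cost}(T)=O(|T|)$, so that $\beta$ is finite, and that the limit defining $\alpha$ exists.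 *)

(* Defs.v *)
From mathcomp Require Import all_boot all_order all_algebra.
From mathcomp Require Import all_classical all_reals all_analysis.
From mathcomp Require Import zify.

Set Implicit Arguments.
Unset Strict Implicit.
Unset Printing Implicit Defensive.

Import Order.TTheory GRing.Theory Num.Theory.
Import numFieldNormedType.Exports.

Local Open Scope classical_set_scope.
Local Open Scope ring_scope.

Inductive btree : Type := Empty | Node (l r : btree).

Fixpoint nodes (t : btree) : nat :=
  if t is Node l r then (nodes l + nodes r).+1 else 0%N.

(* The value at Empty is a dummy. *)
Fixpoint height (t : btree) : nat :=
  match t with
  | Empty | Node Empty Empty => 0
  | Node l Empty => (height l).+1
  | Node Empty r => (height r).+1
  | Node l r => (maxn (height l) (height r)).+1
  end.

Fixpoint maximal_tree (h : nat) : btree :=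
  if h is h'.+1 then Node (maximal_tree h') (maximal_tree h')
  else Node Empty Empty.

(* A node is given by its address: the links followed from the root down to
   it, with false = left and true = right. *)
Definition address := seq bool.

Fixpoint inorder (t : btree) : seq address :=
  if t is Node l r then
    [seq false :: a | a <- inorder l] ++ [::] :: [seq true :: a | a <- inorder r]
  else [::].

Definition rotate_root (b : bool) (t : btree) : btree :=
  match b, t with
  | false, Node (Node u v) w => Node u (Node v w)
  | true, Node u (Node v w) => Node (Node u v) w
  | _, _ => t
  end.

(* Rotates the edge joining the node at a to its parent (a != [::]).  That node
   moves to the former address of its parent. *)
Fixpoint rotate (a : address) (t : btree) : btree :=
  match a, t with
  | [:: b], _ => rotate_root b t
  | false :: a', Node l r => Node (rotate a' l) r
  | true :: a', Node l r => Node l (rotate a' r)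
  | _, _ => t
  end.

(* Splays the node x whose REVERSED address is up, and returns the final tree
   with the number of rotations.  When up = c :: b :: q, the parent p of x is at
   rev (b :: q) and its grandparent g is at rev q.  After the first rotation of
   either double step, x is at rev (b :: q), so the second rotation is performed
   there (its upper end being p for a zigzig, g for a zigzag) and brings x to
   rev q. *)
Fixpoint splay_up (up : seq bool) (t : btree) : btree * nat :=
  match up with
  | [::] => (t, 0%N)
  | [:: c] => (rotate [:: c] t, 1%N)
  | c :: b :: q =>
      let t1 := if c == b then rotate (rev (b :: q)) t
                else rotate (rev (c :: b :: q)) t in
      let t2 := rotate (rev (b :: q)) t1 in
      let: (t', k) := splay_up q t2 in (t', k.+2)
  end.

Definition splay (x : address) (t : btree) : btree * nat := splay_up (rev x) t.

(* Rotations preserve the inorder, so the i-th node of the initial tree is the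
   i-th node of the current tree s.1; s.2 is the number of rotations so far. *)
Definition traversal_step (s : btree * nat) (i : nat) : btree * nat :=
  let: (t', k) := splay (nth [::] (inorder s.1) i) s.1 in (t', (s.2 + k)%N).

Definition traversal (t : btree) : btree * nat :=
  foldl traversal_step (t, 0%N) (iota 0 (nodes t)).

Definition cost (t : btree) : nat := (traversal t).2.

Definition cost_ratio (R : realType) (t : btree) : R :=
  (cost t)%:R / (nodes t)%:R.

Definition asymptotic_bounds (R : realType) : set R :=
  [set b | forall e : R, 0 < e ->
     exists N : nat, forall t : btree, t <> Empty ->
       (N <= nodes t)%N -> cost_ratio R t < b + e].

Arguments asymptotic_bounds R : clear implicits.

(* The infimum is taken in the extended reals, so that it needs no side
   condition. *)
Definition beta (R : realType) : \bar R :=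
  ereal_inf [set b%:E | b in asymptotic_bounds R].

Lemma height_node (l r : btree) : l <> Empty -> r <> Empty ->
  height (Node l r) = (maxn (height l) (height r)).+1.
Proof. by case: l => // a b; case: r. Qed.

Lemma nodes_maximal_tree (h : nat) : nodes (maximal_tree h) = (2 ^ h.+1 - 1)%N.
Proof. by elim: h => [//|h /= ->]; have := expn_gt0 2 h.+1; rewrite !expnS; lia. Qed.

Lemma height_maximal_tree (h : nat) : height (maximal_tree h) = h.
Proof. by elim: h => [//|h IH] /=; rewrite IH maxnn; case: h IH. Qed.

Lemma nodes_leq (t : btree) : (nodes t <= 2 ^ (height t).+1 - 1)%N.
Proof.
elim: t => [//|l IHl r IHr].
case: l IHl => [|a b] IHl; case: r IHr => [|c d] IHr //.
- have -> : height (Node Empty (Node c d)) = (height (Node c d)).+1 by [].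
  by move: IHr => /=; rewrite !expnS; lia.
- have -> : height (Node (Node a b) Empty) = (height (Node a b)).+1 by [].
  by move: IHl => /=; rewrite !expnS; lia.
rewrite height_node //; set t1 := Node a b in IHl *; set t2 := Node c d in IHr *.
have h1 : (2 ^ (height t1).+1 <= 2 ^ (maxn (height t1) (height t2)).+1)%N.
  by rewrite leq_exp2l // ltnS leq_maxl.
have h2 : (2 ^ (height t2).+1 <= 2 ^ (maxn (height t1) (height t2)).+1)%N.
  by rewrite leq_exp2l // ltnS leq_maxr.
have := expn_gt0 2 (height t1).+1; have := expn_gt0 2 (height t2).+1.
rewrite [(2 ^ _.+2)%N]expnS; move: IHl IHr h1 h2.
rewrite -[nodes (Node t1 t2)]/((nodes t1 + nodes t2).+1).
move: (2 ^ _)%N (2 ^ _)%N (2 ^ _)%N => x y z; lia.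
Qed.

Lemma maximal_tree_unique (h : nat) (t : btree) : t <> Empty ->
  height t = h -> nodes t = (2 ^ h.+1 - 1)%N -> t = maximal_tree h.
Proof.
elim: h t => [|h IH] [//|l r] _.
  by case: l r => [|a b] [|c d].
have N : forall (u : btree) (k : nat), (height u <= k)%N -> (nodes u <= 2 ^ k.+1 - 1)%N.
  move=> u k uk; apply: leq_trans (nodes_leq u) _.
  by rewrite leq_sub2r // leq_exp2l.
have P : (2 <= 2 ^ h.+1)%N by rewrite expnS; have := expn_gt0 2 h; lia.
case: l => [|a b]; case: r => [|c d] //.
- rewrite -[height _]/(height (Node c d)).+1 => /succn_inj hm; move: (N (Node c d) h).
  rewrite hm leqnn (expnS 2 h.+1) => /(_ isT).
  by rewrite -[nodes (Node Empty _)]/(nodes (Node c d)).+1; lia.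
- rewrite -[height _]/(height (Node a b)).+1 => /succn_inj hm; move: (N (Node a b) h).
  rewrite hm leqnn (expnS 2 h.+1) => /(_ isT).
  rewrite -[nodes (Node _ Empty)]/(nodes (Node a b) + 0).+1; lia.
rewrite height_node //; set t1 := Node a b; set t2 := Node c d.
rewrite -[nodes (Node t1 t2)]/((nodes t1 + nodes t2).+1) => -[] hm.
have h1 : (height t1 <= h)%N by rewrite -hm leq_maxl.
have h2 : (height t2 <= h)%N by rewrite -hm leq_maxr.
have n1 := N t1 h h1; have n2 := N t2 h h2.
rewrite (expnS 2 h.+1) => E.
have e1 : nodes t1 = (2 ^ h.+1 - 1)%N by lia.
have e2 : nodes t2 = (2 ^ h.+1 - 1)%N by lia.
have lt_h (u : btree) : (height u <= h)%N -> nodes u = (2 ^ h.+1 - 1)%N -> height u = h.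
  move=> uh e; apply/eqP; rewrite eqn_leq uh leqNgt; apply/negP => uh'.
  have := nodes_leq u; rewrite e.
  have : (2 ^ (height u).+1 <= 2 ^ h)%N by rewrite leq_exp2l.
  by have := expn_gt0 2 h; rewrite (expnS 2 h); lia.
have -> : t1 = maximal_tree h by apply: IH => //; apply: lt_h.
by have -> : t2 = maximal_tree h by apply: IH => //; apply: lt_h.
Qed.

(* Main.v *)
Require Import Defs.
From mathcomp Require Import all_boot all_order all_algebra.
From mathcomp Require Import all_classical all_reals all_analysis.
From mathcomp Require Import zify lra.

Import Order.TTheory GRing.Theory Num.Theory.
Import numFieldNormedType.Exports.
Import Defs.

Local Open Scope classical_set_scope.
Local Open Scope ring_scope.

(** Once a node has been splayed to the root, everything before it hangs in the
left subtree and is never touched again, so the traversal amounts to deleting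
the nodes one by one from the remaining right part.  Describe that part by the
list of right subtrees hanging from its left spine, read from the bottom up.
Splaying the bottom node zigzigs the rest of the spine away two nodes at a time:
the list [a :: s] becomes [spine a ++ pair_up s], where [pair_up] joins
consecutive entries under a common node, at a cost of [size s] rotations
([splay_up_spine]).  Every splay but the first pays one further rotation for the
link from the root to the right part.  This gives a formula for the cost in
terms of lists alone ([cost_spine]).

For the lower bound, let a long left spine of 2 ^ h bare nodes sit above a
bottom node whose right subtree is a right path of h nodes ([comb h]).  Each of
the first h deletions removes a node whose right subtree is a right path and so
has a spine of a single node: it merely replaces the bottom entry by a shorter
path, while [pair_up] halves the upper part of the list and turns its entries,
equal perfect trees, into perfect trees one level higher.  These halvings cost
2 ^ h + 2 ^ (h - 1) + ... + 2, about twice the number of nodes, and they end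
with one perfect tree of 2 ^ h - 1 nodes that is still to be traversed
([deletion_cost_halving], [cost_comb]).  The comb has only h + 2 more nodes than
this tree, so its cost per node is asymptotically 2 more than that of maximal
trees. *)

(** * Left spines *)

Fixpoint spine (t : btree) : seq btree :=
  if t is Node l r then rcons (spine l) r else [::].

(** [foldl Node u s] is the tree with [u] at the bottom of a left spine from which
the subtrees [s] hang. *)
Lemma spine_foldl (u : btree) (s : seq btree) :
  spine (foldl Node u s) = spine u ++ s.
Proof.
elim/last_ind: s => [|s a IH]; first by rewrite cats0.
by rewrite foldl_rcons /= IH rcons_cat.
Qed.

Lemma spineK (t : btree) : foldl Node Empty (spine t) = t.
Proof. by elim: t => [//|l IHl r _] /=; rewrite foldl_rcons IHl. Qed.

Lemma nodes_foldl (u : btree) (s : seq btree) :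
  nodes (foldl Node u s) = (nodes u + \sum_(a <- s) (nodes a).+1)%N.
Proof.
elim: s u => [|a s IH] u; first by rewrite big_nil addn0.
by rewrite /= IH big_cons /=; lia.
Qed.

Lemma size_inorder (t : btree) : size (inorder t) = nodes t.
Proof. by elim: t => [//|l IHl r IHr] /=; rewrite size_cat /= !size_map IHl IHr addnS. Qed.

Lemma inorder_first (B : btree) (s : seq btree) :
  nth [::] (inorder (foldl Node (Node Empty B) s)) 0 = nseq (size s) false.
Proof.
elim/last_ind: s => [//|s a IH].
have pos : (0 < nodes (foldl Node (Node Empty B) s))%N by rewrite nodes_foldl.
rewrite foldl_rcons size_rcons /= nth_cat size_map size_inorder pos.
by rewrite (nth_map [::]) ?size_inorder // IH.
Qed.

(** The links of the spine that lie above [u] only locate the rotation. *)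
Lemma rotate_spine (a : address) (u : btree) (s : seq btree) : a != [::] ->
  rotate (nseq (size s) false ++ a) (foldl Node u s) = foldl Node (rotate a u) s.
Proof.
move=> a0; elim/last_ind: s => [//|s b IH].
rewrite size_rcons !foldl_rcons -IH /=.
have : nseq (size s) false ++ a != [::].
  by move: a0; rewrite -!size_eq0 size_cat addn_eq0 negb_and => ->; rewrite orbT.
by case: (_ ++ _).
Qed.

(** * Splaying the first node of a subtree *)

(** The effect of the zigzigs on the part of the spine above the splayed node; an
entry left alone at the top is handled by the final zig or zigzag. *)
Fixpoint pair_up (s : seq btree) : seq btree :=
  match s with
  | a :: b :: s' => Node a b :: pair_up s'
  | _ => s
  end.

Lemma nodes_pair_up (s : seq btree) :
  (\sum_(a <- pair_up s) (nodes a).+1 = \sum_(a <- s) (nodes a).+1)%N.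
Proof.
have [n] := ubnP (size s); elim: n s => // n IH [//|a [//|b s]] /= lt_s_n.
by rewrite !big_cons IH /=; lia.
Qed.

(** The spine is climbed by zigzigs, each of which turns the entries [a] and [b]
above the splayed node into [Node a b] on the spine of its right subtree.  The
context [C], entered along [rev p], stands for what lies above the spine; [F]
and [k] are the outcome of the splay once at most one spine node is left above
the splayed node.  The third hypothesis says that a spine node left alone at the
top keeps its subtree and costs one rotation more.  It holds for a final zig
([p] empty) as well as for a final zigzag ([p = [:: true]]), so both share one
climb. *)
Lemma splay_up_spine (p : seq bool) (C F : btree -> btree) (k : nat) :
    (forall a u, a != [::] -> rotate (rev p ++ a) (C u) = C (rotate a u)) ->
    (forall B, splay_up p (C (Node Empty B)) = (F B, k)) ->
    (forall B A, splay_up (false :: p) (C (Node (Node Empty B) A)) =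
       (F (Node B A), k.+1)) ->
  forall B s,
  splay_up (nseq (size s) false ++ p) (C (foldl Node (Node Empty B) s)) =
    (F (foldl Node B (pair_up s)), (size s + k)%N).
Proof.
move=> rotC splay0 splay1 B s.
have [n] := ubnP (size s); elim: n B s => // n IH B [|a [|b s]] lt_s_n.
- exact: splay0.
- exact: splay1.
rewrite /= in lt_s_n *.
(* Both rotations of a zigzig take place at the address of the current parent. *)
have rot v : rotate (rev (false :: (nseq (size s) false ++ p))) (C (foldl Node v s))
    = C (foldl Node (rotate [:: false] v) s).
  rewrite rev_cons rev_cat rcons_cat rotC; last by case: (rev _).
  rewrite rev_nseq.
  by rewrite -cats1 rotate_spine.
rewrite !rot /= IH; last by lia.
by [].
Qed.

Lemma splay_first (B : btree) (s : seq btree) :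
  splay (nseq (size s) false) (foldl Node (Node Empty B) s) =
    (Node Empty (foldl Node B (pair_up s)), size s).
Proof.
rewrite /splay rev_nseq -[nseq _ _]cats0 -[size s in RHS]addn0.
exact: (@splay_up_spine [::] id).
Qed.

(** When [size s] is odd, the top spine node and the root are passed together by a
zigzag; when it is even, the root is passed alone by a zig. *)
Lemma splay_next (l B : btree) (s : seq btree) :
  splay (true :: nseq (size s) false) (Node l (foldl Node (Node Empty B) s)) =
    (Node (Node l Empty) (foldl Node B (pair_up s)), (size s).+1).
Proof.
rewrite /splay rev_cons rev_nseq -cats1 -addn1.
by apply: (@splay_up_spine [:: true] (Node l) (Node (Node l Empty))) => // -[].
Qed.

(** * The cost of a traversal in terms of spines *)

(** On spines: the deletion of the first node after it has been splayed to the
root. *)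
Definition delete_first (s : seq btree) : seq btree :=
  if s is a :: s' then spine a ++ pair_up s' else [::].

(** The recursion is on the number of deletions because [delete_first] is not
structurally decreasing. *)
Fixpoint deletion_cost (n : nat) (s : seq btree) : nat :=
  if n is n'.+1 then ((size s).-1 + deletion_cost n' (delete_first s))%N else 0%N.

Lemma traversal_from (l r : btree) (k : nat) :
  (foldl traversal_step (Node l r, k) (iota (nodes l).+1 (nodes r))).2 =
    (k + nodes r + deletion_cost (nodes r) (spine r))%N.
Proof.
move Em: (nodes r) => m; elim: m l r k Em => [|m IH] l r k Em.
  by rewrite /= !addn0.
move: Em; rewrite -(spineK r); case: (spine r) => [//|B s].
rewrite [foldl Node _ _]/(foldl Node (Node Empty B) s) => Em.
rewrite [iota _ _]/= [foldl traversal_step _ _]/=.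
rewrite {2}/traversal_step /=.
rewrite nth_cat size_map size_inorder ltnNge leqnSn /= subSnn /=.
rewrite (nth_map [::]) ?size_inorder ?Em // inorder_first splay_next.
have Em' : nodes (foldl Node B (pair_up s)) = m.
  by move: Em; rewrite !nodes_foldl nodes_pair_up /=; lia.
have := IH (Node l Empty) _ (k + (size s).+1)%N Em'.
rewrite /= addn0 => ->.
rewrite !spine_foldl /=; lia.
Qed.

(** The term [(nodes t).-1] counts the rotation with the current root, paid by
each node except the first. *)
Lemma cost_spine (t : btree) :
  cost t = ((nodes t).-1 + deletion_cost (nodes t) (spine t))%N.
Proof.
rewrite -(spineK t); case: (spine t) => [//|B s].
rewrite [foldl Node _ _]/(foldl Node (Node Empty B) s).
rewrite /cost /traversal.
have En : nodes (foldl Node (Node Empty B) s) = (nodes (foldl Node B (pair_up s))).+1.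
  by rewrite !nodes_foldl nodes_pair_up.
rewrite En [iota _ _]/= [foldl traversal_step _ _]/=.
rewrite {2}/traversal_step [(_, _).1]/= inorder_first splay_first.
have := traversal_from Empty (foldl Node B (pair_up s)) (0 + size s).
rewrite /= => ->.
rewrite !spine_foldl /=; lia.
Qed.

(** * A comb that becomes a maximal tree *)

Fixpoint right_path (n : nat) : btree :=
  if n is n'.+1 then Node Empty (right_path n') else Empty.

(** The maximal trees preceded by the empty tree, so that the spine of bare nodes
is the level 0 of the halvings. *)
Fixpoint perfect (n : nat) : btree :=
  if n is n'.+1 then Node (perfect n') (perfect n') else Empty.

Lemma perfectS (h : nat) : perfect h.+1 = maximal_tree h.
Proof. by elim: h => [//|h IH]; rewrite /= -IH. Qed.

Definition comb (h : nat) : btree :=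
  foldl Node (Node Empty (right_path h)) (nseq (2 ^ h) Empty).

Lemma pair_up_nseq (n : nat) (t : btree) :
  pair_up (nseq (2 * n) t) = nseq n (Node t t).
Proof. by rewrite mul2n; elim: n => [//|n IH]; rewrite doubleS /= IH. Qed.

(** Deleting the first node halves the list above it and shortens the path by one,
since the spine of [right_path h.+1] is [[:: right_path h]]; as the lengths are
powers of 2, no entry is ever left unpaired. *)
Lemma deletion_cost_halving (h i n : nat) :
  deletion_cost (h + n) (right_path h :: nseq (2 ^ h) (perfect i)) =
    (2 ^ h.+1 - 2 + deletion_cost n [:: Empty; perfect (h + i)])%N.
Proof.
elim: h i => [//|h IH] i.
rewrite addSn [LHS]/= size_nseq (expnS 2 h) pair_up_nseq.
rewrite [nseq _ (Node _ _)]/(nseq (2 ^ h) (perfect i.+1)) IH addnS addSn.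
have := expn_gt0 2 h; rewrite !expnS; lia.
Qed.

Lemma nodes_right_path (n : nat) : nodes (right_path n) = n.
Proof. by elim: n => //= n ->. Qed.

Lemma nodes_comb (h : nat) : nodes (comb h) = (2 ^ h + h + 1)%N.
Proof.
rewrite nodes_foldl big_nseq iter_addn /= nodes_right_path; lia.
Qed.

(** After the halvings, the deletion of the now childless first node costs 1 and
that of the last spine node is free; what remains is the spine of the maximal
tree. *)
Lemma cost_comb (h : nat) :
  cost (comb h.+1) = (2 * 2 ^ h.+1 + h + 2 + cost (maximal_tree h))%N.
Proof.
rewrite !cost_spine nodes_comb spine_foldl nodes_maximal_tree.
have gt0 := expn_gt0 2 h.
(* [h.+1] halvings, the two deletions after them, and one for each node of the
   maximal tree. *)
have -> : (2 ^ h.+1 + h.+1 + 1 = h.+1 + (2 ^ h.+1 - 1).+2)%N.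
  by rewrite expnS; lia.
rewrite [spine (Node Empty _)]/= cat1s.
rewrite (deletion_cost_halving _ 0).
rewrite addn0 perfectS [deletion_cost _.+2 _]/= cats0.
rewrite !expnS; lia.
Qed.

(** * The limit *)

Lemma comb_excess_bound (h : nat) : ((h + 3) * h.+1 <= 3 * (2 ^ h.+1 - 1))%N.
Proof.
elim: h => [//|h IH]; rewrite expnS.
have : (h.+2 <= 2 ^ h.+1)%N by apply: ltn_expl.
have := expn_gt0 2 h; move: IH; rewrite !expnS; nia.
Qed.

Lemma comb_excess_vanishes (R : realType) :
  (h + 3)%:R / (nodes (maximal_tree h))%:R @[h --> \oo] --> (0 : R).
Proof.
have harm0 : 3 * harmonic h @[h --> \oo] --> (0 : R).
  by rewrite -(mulr0 3); apply: cvgMl_tmp; exact: cvg_harmonic.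
apply: (squeeze_cvgr _ (cvg_cst 0) harm0); near=> h.
have N_gt0 : (0 < nodes (maximal_tree h))%N by case: (h).
rewrite divr_ge0 ?ler0n //= ler_pdivrMr ?ltr0n // mulrAC ler_pdivlMr ?ltr0n //.
by rewrite -!natrM ler_nat nodes_maximal_tree comb_excess_bound.
Unshelve. all: by end_near. Qed.

(** The bound on the ratio of the comb, cleared of its denominator and divided by
the number of nodes of the maximal tree instead, so that only the limit of
[comb_excess_vanishes] is needed to pass to the limit. *)
Lemma comb_ratio_lt (R : realType) (h : nat) (c : R) :
  cost_ratio R (comb h.+1) < c ->
  2 + cost_ratio R (maximal_tree h)
    - c * ((h + 3)%:R / (nodes (maximal_tree h))%:R) <= c.
Proof.
have nodesE : nodes (comb h.+1) = (nodes (maximal_tree h) + (h + 3))%N.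
  by rewrite nodes_comb nodes_maximal_tree; have := expn_gt0 2 h.+1; lia.
have costE : cost (comb h.+1) =
    (2 * nodes (maximal_tree h) + cost (maximal_tree h) + (h + 4))%N.
  by rewrite cost_comb nodes_maximal_tree; have := expn_gt0 2 h.+1; lia.
have N_gt0 : 0 < (nodes (maximal_tree h))%:R :> R by rewrite ltr0n; case: (h).
rewrite /cost_ratio nodesE costE ltr_pdivrMr; last first.
  by rewrite natrD ltr_wpDr ?ler0n.
rewrite lerBlDr -(ler_pM2r N_gt0) !mulrDl -[c * _ * _]mulrA !divfK ?gt_eqF //.
rewrite 2![in X in X < _]natrD natrM !natrD => lt_c.
have : 0 <= h%:R :> R by rewrite ler0n.
by lra.
Qed.

Theorem theorem8 (R : realType) (alpha : R)
  (alpha_lim : cost_ratio R (maximal_tree h) @[h --> \oo] --> alpha) :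
  ((2 + alpha)%:E <= beta R)%E.
Proof.
apply: le_ereal_inf_tmp => _ [b b_bound <-]; rewrite lee_fin.
apply/ler_addgt0Pr => e e_gt0; have [N below] := b_bound e e_gt0.
have lim : 2 + cost_ratio R (maximal_tree h)
    - (b + e) * ((h + 3)%:R / (nodes (maximal_tree h))%:R) @[h --> \oo]
    --> 2 + alpha - (b + e) * 0.
  apply: cvgB; first by apply: cvgD => //; exact: cvg_cst.
  by apply: cvgMl_tmp; exact: comb_excess_vanishes.
rewrite mulr0 subr0 in lim.
apply: (cvgr_to_le lim); near=> h.
apply: comb_ratio_lt; apply: below.
  by move/(congr1 nodes); rewrite nodes_comb addn1.
rewrite nodes_comb; apply: (@leq_trans h); last by lia.
by near: h; exact: nbhs_infty_ge.
Unshelve. all: by end_near. Qed.
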